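(* Let $a<-1$ be real. Then for all real $x>0$ $$g_a^{\mathsf{lo}}(x)<\Gamma(a,x)<g_a^{\mathsf{up}}(x),$$ where $$g_a^{\mathsf{lo}}(x):=\frac{x^a e^{-x}(x-a-1)}{(x-a)^2+a}\quad\text{and}\quad g_a^{\mathsf{up}}(x):=\frac{x^a e^{-x}}{x-a}.$$ Also, each of the bounds $g_a^{\mathsf{lo}}(x)$ and $g_a^{\mathsf{up}}(x)$ on $\Gamma(a,x)$ is exact both at $x=0$ and at $x=\infty$. Moreover, the statements concerning $g_a^{\mathsf{up}}$ hold for all real $a<0$: for every real $a<0$, $\Gamma(a,x)<g_a^{\mathsf{up}}(x)$ for all real $x>0$, and $g_a^{\mathsf{up}}(x)$ is exact both at $x=0$ and at $x=\infty$.
   Context: For real $a$ and real $x>0$, $\Gamma(a,x):=\int_x^\infty t^{a-1}e^{-t}\,dt$. A bound $B_a(x)$ on $\Gamma(a,x)$ is called exact at $x=0$ if $B_a(x)/\Gamma(a,x)\to1$ as $x\downarrow0$, and exact at $x=\infty$ if $B_a(x)/\Gamma(a,x)\to1$ as $x\to\infty$. *)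

(* Defs.v *)
From Stdlib Require Import Reals.
From Coquelicot Require Import Coquelicot.
Open Scope R_scope.

(* [Rpower t b] is the real power t^b only for t > 0; below it is only
   evaluated (or integrated) over positive reals. *)

Definition Gamma (a x : R) : R :=
  RInt_gen (fun t : R => Rpower t (a - 1) * exp (- t))
           (at_point x) (Rbar_locally p_infty).

Definition g_lo (a x : R) : R :=
  Rpower x a * exp (- x) * (x - a - 1) / ((x - a) ^ 2 + a).

Definition g_up (a x : R) : R :=
  Rpower x a * exp (- x) / (x - a).

Definition exact_at_zero (a : R) (B : R -> R) : Prop :=
  filterlim (fun x : R => B x / Gamma a x) (at_right 0) (locally 1).

Definition exact_at_infty (a : R) (B : R -> R) : Prop :=
  is_lim (fun x : R => B x / Gamma a x) p_infty 1.

(* Main.v *)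
(** With f(t) = t^(a-1) e^(-t), differentiation gives
      g_up' = - f (1 + x / (x-a)^2)   and
      g_lo' = - f (1 - 2 x^2 / ((x-a)^2 + a)^2),
    so Gamma(a, .), whose derivative is - f, decreases more slowly than g_up and
    faster than g_lo, while all three tend to 0 at infinity; this yields both
    bounds (for every a < 0, the lower one wherever (x-a)^2 + a > 0 on
    [x, +oo)).  Since g_lo / g_up = 1 - x / ((x-a)^2 + a) tends to 1 at
    infinity, the bounds squeeze Gamma there.  At 0 the range -1 <= a < 0 has no
    lower bound g_lo, so one uses instead
      Gamma(a, x) >= int_x^y f >= e^(-y) (x^a - y^a) / (-a)   with y = sqrt x. *)

Require Import Defs.
From Stdlib Require Import Reals Lra.
From Coquelicot Require Import Coquelicot.
Open Scope R_scope.

(** * The integrand and its partial integrals *)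

Definition Gamma_integrand (a t : R) : R := Rpower t (a - 1) * exp (- t).

Lemma Rpower_pos (x b : R) : 0 < Rpower x b.
Proof. apply exp_pos. Qed.

Lemma Rpower_pred (x a : R) : 0 < x -> Rpower x a = x * Rpower x (a - 1).
Proof.
intros Hx.
rewrite <- (Rpower_1 x Hx) at 2.
rewrite <- Rpower_plus. f_equal. ring.
Qed.

Lemma Gamma_integrand_pos (a t : R) : 0 < Gamma_integrand a t.
Proof. apply Rmult_lt_0_compat; [apply Rpower_pos | apply exp_pos]. Qed.

Lemma Gamma_integrand_continuous (a t : R) :
  0 < t -> continuous (Gamma_integrand a) t.
Proof.
intros Ht. apply (ex_derive_continuous (Gamma_integrand a)).
unfold Gamma_integrand, Rpower. auto_derive. exact Ht.
Qed.

Lemma Gamma_integrand_ex_RInt (a x y : R) :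
  0 < x -> 0 < y -> ex_RInt (Gamma_integrand a) x y.
Proof.
intros Hx Hy. apply (ex_RInt_continuous (Gamma_integrand a)).
intros z [Hz _]. apply Gamma_integrand_continuous.
apply Rlt_le_trans with (2 := Hz). now apply Rmin_glb_lt.
Qed.

Lemma Gamma_partial_derive (a x y : R) :
  0 < x -> 0 < y ->
  is_derive (RInt (Gamma_integrand a) x) y (Gamma_integrand a y).
Proof.
intros Hx Hy.
apply (is_derive_RInt (Gamma_integrand a) (RInt (Gamma_integrand a) x) x y).
- exists (mkposreal y Hy). intros z Hz.
  apply (RInt_correct (V := R_CompleteNormedModule)).
  apply Gamma_integrand_ex_RInt; [exact Hx |].
  unfold ball in Hz; simpl in Hz.
  unfold AbsRing_ball, abs, minus, plus, opp in Hz; simpl in Hz.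
  apply Rabs_def2 in Hz. lra.
- now apply Gamma_integrand_continuous.
Qed.

Lemma Gamma_partial_at_start (a x : R) : RInt (Gamma_integrand a) x x = 0.
Proof. apply (RInt_point x (Gamma_integrand a)). Qed.

(** The common engine of all the estimates: the sign of the integrand plus [dF] decides whether the
    partial integral plus [F] rises or falls. [F = 0] gives monotonicity, the two bounds give the
    inequalities, and a multiple of a power serves near 0. *)
Lemma derive_sum_MVT (a x y z : R) (F dF : R -> R) :
  0 < x -> x <= y < z ->
  (forall t, y <= t <= z -> is_derive F t (dF t)) ->
  exists c, y <= c <= z /\
    (RInt (Gamma_integrand a) x z + F z) - (RInt (Gamma_integrand a) x y + F y)
    = (Gamma_integrand a c + dF c) * (z - y).
Proof.
intros Hx Hyz HF.
assert (HD : forall t, y <= t <= z ->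
  is_derive (fun t => RInt (Gamma_integrand a) x t + F t) t
    (Gamma_integrand a t + dF t)).
{ intros t Ht.
  apply (is_derive_plus (RInt (Gamma_integrand a) x) F).
  - apply Gamma_partial_derive; lra.
  - now apply HF. }
destruct (MVT_gen (fun t => RInt (Gamma_integrand a) x t + F t) y z
  (fun t => Gamma_integrand a t + dF t)) as [c [Hc E]].
- rewrite Rmin_left, Rmax_right by lra. intros t Ht. apply HD. lra.
- rewrite Rmin_left, Rmax_right by lra. intros t Ht.
  apply continuity_pt_filterlim.
  apply (ex_derive_continuous (fun t => RInt (Gamma_integrand a) x t + F t)).
  eexists. now apply HD.
- rewrite Rmin_left, Rmax_right in Hc by lra.
  exists c. split; [exact Hc | exact E].
Qed.

Lemma Gamma_partial_incr (a x y z : R) :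
  0 < x -> x <= y <= z ->
  RInt (Gamma_integrand a) x y <= RInt (Gamma_integrand a) x z.
Proof.
intros Hx [Hy Hz]. destruct Hz as [Hz | ->]; [| lra].
destruct (derive_sum_MVT a x y z (fun _ => 0) (fun _ => 0)) as [c [Hc E]];
  [lra | lra | |].
- intros t _. apply (is_derive_const (V := R_NormedModule) 0 t).
- generalize (Gamma_integrand_pos a c); intros Hp. nra.
Qed.

(** * Improper integrals as limits of partial integrals *)

Lemma is_lim_incr_bounded (f : R -> R) (x M : R) :
  (forall y z, x <= y <= z -> f y <= f z) ->
  (forall y, x <= y -> f y <= M) ->
  exists l : R, is_lim f p_infty l.
Proof.
intros Hincr HM.
destruct (completeness (fun v => exists y, x <= y /\ v = f y)) as [l [Hub Hl]].
- exists M. intros v [y [Hy ->]]. now apply HM.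
- exists (f x), x. split; lra.
- exists l. apply is_lim_spec. intros eps.
  assert (He := cond_pos eps).
  assert (Hy : exists y, x <= y /\ l - eps < f y).
  { destruct (Classical_Prop.classic (exists y, x <= y /\ l - eps < f y))
      as [H | H]; [exact H | exfalso].
    assert (l <= l - eps); [| lra].
    apply Hl. intros v [y [Hy ->]]. apply Rnot_lt_le. intros Hlt.
    apply H. now exists y. }
  destruct Hy as [y [Hy Hly]]. exists y. intros z Hz.
  assert (f y <= f z) by (apply Hincr; lra).
  assert (f z <= l) by (apply Hub; exists z; split; lra).
  apply Rabs_def1; lra.
Qed.

Lemma is_RInt_gen_of_is_lim (f : R -> R) (x l : R) :
  (forall y, x <= y -> ex_RInt f x y) ->
  is_lim (RInt f x) p_infty l ->
  is_RInt_gen f (at_point x) (Rbar_locally p_infty) l.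
Proof.
intros Hex Hl P HP.
destruct (Hl P HP) as [M HM].
(* The lower end is pinned to [x]; the maximum makes the upper end exceed both [x], for
   integrability, and [M], for the limit. *)
apply (Filter_prod _ _ _ (fun u => u = x) (fun y => Rmax x M < y)).
- reflexivity.
- now exists (Rmax x M).
- intros u y -> Hy. simpl.
  exists (RInt f x y). split.
  + apply (RInt_correct (V := R_CompleteNormedModule)). apply Hex.
    generalize (Rmax_l x M). lra.
  + apply HM. generalize (Rmax_r x M). lra.
Qed.

(** * Derivatives, limits and quotient of the two bounds *)

Lemma g_up_derive (a x : R) :
  a < 0 -> 0 < x ->
  is_derive (g_up a) x (- Gamma_integrand a x * (1 + x / (x - a) ^ 2)).
Proof.
intros Ha Hx. unfold g_up, Gamma_integrand.
(* To [field] the powers with exponents [a] and [a - 1] are unrelated atoms; [E] links them. *)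
assert (E := Rpower_pred x a Hx). unfold Rpower in *.
auto_derive.
- repeat split; lra.
- rewrite E. field. lra.
Qed.

Lemma g_lo_derive (a x : R) :
  0 < x -> 0 < (x - a) ^ 2 + a ->
  is_derive (g_lo a) x
    (- Gamma_integrand a x * (1 - 2 * x ^ 2 / ((x - a) ^ 2 + a) ^ 2)).
Proof.
intros Hx HD. unfold g_lo, Gamma_integrand.
assert (E := Rpower_pred x a Hx). unfold Rpower in *.
auto_derive.
- repeat split; lra.
- rewrite E. field. lra.
Qed.

Lemma g_up_pos (a x : R) : a < 0 -> 0 < x -> 0 < g_up a x.
Proof.
intros Ha Hx. apply Rdiv_lt_0_compat; [| lra].
apply Rmult_lt_0_compat; [apply Rpower_pos | apply exp_pos].
Qed.

(** For [x > 1] both [Rpower x a] and [exp (- x)] are at most 1 and [x - a > x], so [/ x]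
    dominates. *)
Lemma g_up_lim (a : R) : a < 0 -> is_lim (g_up a) p_infty 0.
Proof.
intros Ha.
apply (is_lim_le_le_loc (fun _ => 0) (fun x => / x)).
- exists 1. intros x Hx. split; [left; apply g_up_pos; lra |].
  unfold g_up, Rdiv. rewrite <- (Rmult_1_l (/ x)).
  assert (Hp : Rpower x a <= 1).
  { rewrite <- (Rpower_O x) by lra. apply Rle_Rpower; lra. }
  assert (He : exp (- x) <= 1).
  { rewrite <- exp_0. left. apply exp_increasing. lra. }
  assert (P1 := Rpower_pos x a). assert (P2 := exp_pos (- x)).
  apply Rmult_le_compat.
  + nra.
  + left. apply Rinv_0_lt_compat. lra.
  + nra.
  + apply Rinv_le_contravar; lra.
- apply is_lim_const.
- apply (is_lim_inv (fun x => x) p_infty p_infty).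
  + apply is_lim_id.
  + discriminate.
Qed.

(* [g_lo = bounds_ratio * g_up], written so that the limits at [0] and at
   infinity are both visibly [1]. *)
Definition bounds_ratio (a x : R) : R := 1 - x / ((x - a) ^ 2 + a).

Lemma g_lo_ratio (a x : R) :
  a < 0 -> 0 < x -> 0 < (x - a) ^ 2 + a ->
  g_lo a x = bounds_ratio a x * g_up a x.
Proof. intros Ha Hx HD. unfold g_lo, g_up, bounds_ratio. field. lra. Qed.

(** The expansion [x ^ 2 - 2 * a * x + a * (a + 1)] has only positive terms. *)
Lemma g_lo_denom_pos (a x : R) : a < -1 -> 0 < x -> 0 < (x - a) ^ 2 + a.
Proof. intros. nra. Qed.

(** For [-1 < a < 0] the denominator is negative near 0, but [a ^ 2 + a >= - 1 / 4] is outweighed by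
    [x ^ 2 / 2] once [x > 1]. *)
Lemma g_lo_denom_large (a x : R) :
  a < 0 -> 1 < x -> x ^ 2 / 2 < (x - a) ^ 2 + a.
Proof. intros. assert (0 <= (a + 1 / 2) ^ 2) by apply pow2_ge_0. nra. Qed.

Lemma bounds_ratio_lim_infty (a : R) :
  a < 0 -> is_lim (bounds_ratio a) p_infty 1.
Proof.
intros Ha.
apply (is_lim_le_le_loc (fun x => 1 - 2 * / x) (fun _ => 1)).
- exists 1. intros x Hx. unfold bounds_ratio.
  assert (HD := g_lo_denom_large a x Ha Hx).
  set (D := (x - a) ^ 2 + a) in *.
  assert (HD0 : 0 < D) by nra.
  assert (0 < x / D) by (apply Rdiv_lt_0_compat; lra).
  assert (x / D <= 2 * / x); [| split; lra].
  apply (Rmult_le_reg_r D); [lra |].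
  unfold Rdiv. rewrite Rmult_assoc, Rinv_l, Rmult_1_r by lra.
  apply (Rmult_le_reg_l x); [lra |].
  replace (x * (2 * / x * D)) with (2 * D) by (field; lra). nra.
- replace (Finite 1) with (Finite (1 - 0)) by (f_equal; ring).
  apply is_lim_minus'; [apply is_lim_const |].
  rewrite <- (Rbar_mult_0_r 2). apply is_lim_scal_l.
  apply (is_lim_inv (fun x => x) p_infty p_infty).
  + apply is_lim_id.
  + discriminate.
- apply is_lim_const.
Qed.

Lemma g_lo_lim (a : R) : a < 0 -> is_lim (g_lo a) p_infty 0.
Proof.
intros Ha.
apply (is_lim_ext_loc (fun x => bounds_ratio a x * g_up a x)).
- exists 1. intros x Hx. symmetry.
  assert (HD := g_lo_denom_large a x Ha Hx).
  apply g_lo_ratio; nra.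
- rewrite <- (Rbar_mult_0_r 1).
  apply is_lim_mult.
  + now apply bounds_ratio_lim_infty.
  + now apply g_up_lim.
  + exact I.
Qed.

(** * Convergence of the integral and comparison by derivatives *)

(** The upper bound itself forces convergence: the partial integral up to [y] plus [g_up a y]
    decreases from [g_up a x], and [g_up a y] is positive, so the increasing partial integrals stay
    below [g_up a x]. *)
Lemma Gamma_is_lim (a x : R) :
  a < 0 -> 0 < x ->
  is_lim (RInt (Gamma_integrand a) x) p_infty (Gamma a x).
Proof.
intros Ha Hx.
destruct (is_lim_incr_bounded (RInt (Gamma_integrand a) x) x (g_up a x))
  as [l Hl].
- intros y z H. now apply Gamma_partial_incr.
- intros y [Hy | <-].
  + destruct (derive_sum_MVT a x x y (g_up a)
      (fun t => - Gamma_integrand a t * (1 + t / (t - a) ^ 2)))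
      as [c [Hc E]]; [lra | lra | |].
    * intros t Ht. apply g_up_derive; lra.
    * rewrite Gamma_partial_at_start in E.
      assert (Hp := Gamma_integrand_pos a c).
      assert (Hq : 0 < c / (c - a) ^ 2)
        by (apply Rdiv_lt_0_compat; [| apply pow_lt]; lra).
      assert (H0 := g_up_pos a y Ha ltac:(lra)).
      assert (0 < Gamma_integrand a c * (c / (c - a) ^ 2) * (y - x))
        by (apply Rmult_lt_0_compat; [now apply Rmult_lt_0_compat | lra]).
      lra.
  + rewrite Gamma_partial_at_start. left. now apply g_up_pos.
- replace (Gamma a x) with l; [exact Hl |].
  symmetry. unfold Gamma.
  apply (is_RInt_gen_unique (V := R_CompleteNormedModule)).
  apply (is_RInt_gen_of_is_lim (Gamma_integrand a)); [| exact Hl].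
  intros y Hy. apply Gamma_integrand_ex_RInt; lra.
Qed.

Lemma Gamma_partial_le (a x y : R) :
  a < 0 -> 0 < x -> x <= y -> RInt (Gamma_integrand a) x y <= Gamma a x.
Proof.
intros Ha Hx Hy.
apply (is_lim_le_loc (fun _ => RInt (Gamma_integrand a) x y)
  (RInt (Gamma_integrand a) x) p_infty
  (RInt (Gamma_integrand a) x y) (Gamma a x)).
- exists y. intros z Hz. apply Gamma_partial_incr; lra.
- apply is_lim_const.
- now apply Gamma_is_lim.
Qed.

(* The function [y |-> RInt f x y + F y] starts at [F x], tends to
   [Gamma a x], and is strictly decreasing. *)
Lemma Gamma_lt_of_derive (a x : R) (F dF : R -> R) :
  a < 0 -> 0 < x ->
  (forall t, x <= t -> is_derive F t (dF t)) ->
  (forall t, x <= t -> Gamma_integrand a t + dF t < 0) ->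
  is_lim F p_infty 0 ->
  Gamma a x < F x.
Proof.
intros Ha Hx HF Hneg Hlim.
assert (Hdec : forall y z, x <= y < z ->
  RInt (Gamma_integrand a) x z + F z < RInt (Gamma_integrand a) x y + F y).
{ intros y z Hyz.
  destruct (derive_sum_MVT a x y z F dF) as [c [Hc E]]; [lra | lra | |].
  - intros t Ht. apply HF. lra.
  - assert (Hn := Hneg c ltac:(lra)). nra. }
(* A limit preserves only weak inequalities; the strict one is secured on the step from [x] to
   [x + 1]. *)
apply Rle_lt_trans with (RInt (Gamma_integrand a) x (x + 1) + F (x + 1)).
- apply (is_lim_le_loc (fun z => RInt (Gamma_integrand a) x z + F z)
    (fun _ => RInt (Gamma_integrand a) x (x + 1) + F (x + 1)) p_infty
    (Gamma a x) (RInt (Gamma_integrand a) x (x + 1) + F (x + 1))).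
  + exists (x + 1). intros z Hz. left. apply Hdec. lra.
  + replace (Finite (Gamma a x)) with (Finite (Gamma a x + 0))
      by (f_equal; ring).
    apply is_lim_plus'; [now apply Gamma_is_lim | exact Hlim].
  + apply is_lim_const.
- apply Rlt_le_trans with (1 := Hdec x (x + 1) ltac:(lra)).
  rewrite Gamma_partial_at_start. lra.
Qed.

Lemma Gamma_gt_of_derive (a x : R) (F dF : R -> R) :
  a < 0 -> 0 < x ->
  (forall t, x <= t -> is_derive F t (dF t)) ->
  (forall t, x <= t -> 0 < Gamma_integrand a t + dF t) ->
  is_lim F p_infty 0 ->
  F x < Gamma a x.
Proof.
intros Ha Hx HF Hpos Hlim.
assert (Hinc : forall y z, x <= y < z ->
  RInt (Gamma_integrand a) x y + F y < RInt (Gamma_integrand a) x z + F z).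
{ intros y z Hyz.
  destruct (derive_sum_MVT a x y z F dF) as [c [Hc E]]; [lra | lra | |].
  - intros t Ht. apply HF. lra.
  - assert (Hn := Hpos c ltac:(lra)). nra. }
apply Rlt_le_trans with (RInt (Gamma_integrand a) x (x + 1) + F (x + 1)).
- apply Rle_lt_trans with (2 := Hinc x (x + 1) ltac:(lra)).
  rewrite Gamma_partial_at_start. lra.
- apply (is_lim_le_loc
    (fun _ => RInt (Gamma_integrand a) x (x + 1) + F (x + 1))
    (fun z => RInt (Gamma_integrand a) x z + F z) p_infty
    (RInt (Gamma_integrand a) x (x + 1) + F (x + 1)) (Gamma a x)).
  + exists (x + 1). intros z Hz. left. apply Hinc. lra.
  + apply is_lim_const.
  + replace (Finite (Gamma a x)) with (Finite (Gamma a x + 0))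
      by (f_equal; ring).
    apply is_lim_plus'; [now apply Gamma_is_lim | exact Hlim].
Qed.

(** * The two bounds, and a power estimate near 0 *)

Lemma Gamma_lt_g_up (a x : R) : a < 0 -> 0 < x -> Gamma a x < g_up a x.
Proof.
intros Ha Hx.
apply (Gamma_lt_of_derive a x (g_up a)
  (fun t => - Gamma_integrand a t * (1 + t / (t - a) ^ 2)) Ha Hx).
- intros t Ht. apply g_up_derive; lra.
- intros t Ht. assert (Hp := Gamma_integrand_pos a t).
  assert (Hq : 0 < t / (t - a) ^ 2)
    by (apply Rdiv_lt_0_compat; [| apply pow_lt]; lra).
  nra.
- now apply g_up_lim.
Qed.

(** Positivity is asked on the whole ray so that the lemma covers every [x > 0] when [a < -1], and
    large [x] when only [a < 0]. *)
Lemma g_lo_lt_Gamma (a x : R) :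
  a < 0 -> 0 < x -> (forall t, x <= t -> 0 < (t - a) ^ 2 + a) ->
  g_lo a x < Gamma a x.
Proof.
intros Ha Hx HD.
apply (Gamma_gt_of_derive a x (g_lo a)
  (fun t => - Gamma_integrand a t
            * (1 - 2 * t ^ 2 / ((t - a) ^ 2 + a) ^ 2)) Ha Hx).
- intros t Ht. apply g_lo_derive; [lra | now apply HD].
- intros t Ht. assert (Hp := Gamma_integrand_pos a t).
  assert (Hq : 0 < 2 * t ^ 2 / ((t - a) ^ 2 + a) ^ 2).
  { apply Rdiv_lt_0_compat; [nra | apply pow_lt; now apply HD]. }
  nra.
- now apply g_lo_lim.
Qed.

(* On [[x, y]] one has [exp (- t) >= exp (- y)]. *)
Lemma Gamma_ge_power (a x y : R) :
  a < 0 -> 0 < x < y ->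
  exp (- y) * (Rpower x a - Rpower y a) / - a <= Gamma a x.
Proof.
intros Ha Hxy.
apply Rle_trans with (2 := Gamma_partial_le a x y Ha ltac:(lra) ltac:(lra)).
(* With this [F] the sum has derivative [Rpower t (a - 1) * (exp (- t) - exp (- y))], nonnegative up
   to [y]. *)
destruct (derive_sum_MVT a x x y (fun t => - exp (- y) * Rpower t a / a)
  (fun t => - exp (- y) * Rpower t (a - 1))) as [c [Hc E]]; [lra | lra | |].
- intros t Ht.
  assert (E := Rpower_pred t a ltac:(lra)). unfold Rpower in *.
  auto_derive; [lra |]. rewrite E. field. lra.
- rewrite Gamma_partial_at_start in E. unfold Gamma_integrand in E at 2.
  assert (Hp := Rpower_pos c (a - 1)).
  assert (He : exp (- y) <= exp (- c)).
  { destruct (proj2 Hc) as [H | ->]; [left; apply exp_increasing; lra | lra]. }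
  assert (0 <= (Rpower c (a - 1) * exp (- c)
                + - exp (- y) * Rpower c (a - 1)) * (y - x))
    by (apply Rmult_le_pos; nra).
  replace (exp (- y) * (Rpower x a - Rpower y a) / - a)
    with (- exp (- y) * Rpower x a / a - - exp (- y) * Rpower y a / a)
    by (field; lra).
  lra.
Qed.

(** * Exactness of the upper bound *)

Lemma exact_at_infty_g_up (a : R) : a < 0 -> exact_at_infty a (g_up a).
Proof.
intros Ha.
apply (is_lim_le_le_loc (fun _ => 1) (fun x => / bounds_ratio a x)).
- exists 1. intros x Hx.
  assert (HD : forall t, x <= t -> 0 < (t - a) ^ 2 + a).
  { intros t Ht. assert (H := g_lo_denom_large a t Ha ltac:(lra)). nra. }
  assert (Hup := Gamma_lt_g_up a x Ha ltac:(lra)).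
  assert (Hlo := g_lo_lt_Gamma a x Ha ltac:(lra) HD).
  assert (Hpos := g_up_pos a x Ha ltac:(lra)).
  assert (HDx := HD x ltac:(lra)).
  rewrite (g_lo_ratio a x) in Hlo by lra.
  assert (Hr : 0 < bounds_ratio a x).
  (* The numerator [(x - a) ^ 2 + a - x] factors, and both factors are positive for [x > 1]. *)
  { unfold bounds_ratio.
    replace (1 - x / ((x - a) ^ 2 + a))
      with ((x - a) * (x - a - 1) / ((x - a) ^ 2 + a)) by (field; lra).
    apply Rdiv_lt_0_compat; nra. }
  assert (HG : 0 < Gamma a x) by nra.
  split.
  + apply (Rmult_le_reg_r (Gamma a x)); [lra |].
    unfold Rdiv. rewrite Rmult_assoc, Rinv_l by lra. lra.
  + apply (Rmult_le_reg_r (Gamma a x)); [lra |].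
    unfold Rdiv. rewrite Rmult_assoc, Rinv_l by lra.
    apply (Rmult_le_reg_l (bounds_ratio a x)); [lra |].
    rewrite <- (Rmult_assoc _ (/ _)), Rinv_r by lra. lra.
- apply is_lim_const.
- replace (Finite 1) with (Rbar_inv 1) by (simpl; f_equal; field).
  apply is_lim_inv; [now apply bounds_ratio_lim_infty |].
  intros H. injection H. lra.
Qed.

Lemma continuous_filterlim_at_right (f : R -> R) (x : R) :
  continuous f x -> filterlim f (at_right x) (locally (f x)).
Proof.
intros Hf P HP.
apply (filter_le_within (F := locally x) (fun u => x < u)). exact (Hf P HP).
Qed.

Lemma filterlim_Rpower_at_right_0 (b : R) :
  0 < b -> filterlim (fun x => Rpower x b) (at_right 0) (locally 0).
Proof.
intros Hb. unfold Rpower.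
apply (filterlim_comp _ _ _ (fun x => b * ln x) exp _
  (Rbar_locally m_infty) _).
- apply (filterlim_comp _ _ _ ln (Rmult b) _ (Rbar_locally m_infty) _).
  + apply is_lim_ln_0.
  + replace m_infty with (Rbar_mult b m_infty) at 2.
    * apply (is_lim_scal_l (fun x => x) b m_infty m_infty). apply is_lim_id.
    * simpl. destruct (Rle_dec 0 b) as [H | H]; [| lra].
      destruct (Rle_lt_or_eq_dec 0 b H); [reflexivity | lra].
- apply is_lim_exp_m.
Qed.

(** The choice [y = sqrt x] meets two demands: [y] tends to 0, so [exp (- y)] tends to 1, and [y] is
    large relative to [x], so [Rpower y a] is [Rpower x a] times the vanishing factor
    [Rpower x (- a / 2)]. *)
Lemma exact_at_zero_g_up (a : R) : a < 0 -> exact_at_zero a (g_up a).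
Proof.
intros Ha.
(* The majorant is [Gamma_ge_power] with [y = sqrt x]. *)
apply (filterlim_le_le (F := at_right 0) (fun _ => 1) _
  (fun x => exp (- x) * exp (sqrt x) * (- a / (x - a))
            * / (1 - Rpower x (- a / 2))) 1).
(* Below 1 one has both [x < sqrt x] and [Rpower x (- a / 2) < 1]. *)
- exists (mkposreal 1 Rlt_0_1). intros x Hx Hx0.
  unfold ball in Hx; simpl in Hx.
  unfold AbsRing_ball, abs, minus, plus, opp in Hx; simpl in Hx.
  apply Rabs_def2 in Hx.
  assert (Hs : x < sqrt x).
  { assert (Hs0 := sqrt_lt_R0 x Hx0).
    assert (Hss := sqrt_sqrt x ltac:(lra)). nra. }
  assert (Hge := Gamma_ge_power a x (sqrt x) Ha (conj Hx0 Hs)).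
  assert (Hup := Gamma_lt_g_up a x Ha Hx0).
  assert (Hpow : Rpower (sqrt x) a = Rpower x a * Rpower x (- a / 2)).
  { rewrite <- Rpower_sqrt by lra. rewrite Rpower_mult, <- Rpower_plus.
    f_equal. field. }
  assert (Hlt : Rpower x (- a / 2) < 1).
  { unfold Rpower. rewrite <- exp_0. apply exp_increasing.
    assert (ln x < 0) by (rewrite <- ln_1; apply ln_increasing; lra). nra. }
  rewrite Hpow, exp_Ropp in Hge.
  assert (He := exp_pos (sqrt x)).
  assert (Hp := Rpower_pos x a).
  set (B := / exp (sqrt x) * (Rpower x a - Rpower x a * Rpower x (- a / 2))
            / - a) in Hge.
  assert (HB : 0 < B).
  { unfold B. apply Rdiv_lt_0_compat; [| lra].
    apply Rmult_lt_0_compat; [now apply Rinv_0_lt_compat | nra]. }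
  split.
  + apply (Rmult_le_reg_r (Gamma a x)); [lra |].
    unfold Rdiv. rewrite Rmult_assoc, Rinv_l by lra. lra.
  + apply Rle_trans with (g_up a x / B).
    * apply Rmult_le_compat_l; [left; now apply g_up_pos |].
      apply Rinv_le_contravar; lra.
    * right. unfold g_up, B. field. repeat split; try lra; nra.
- apply filterlim_const.
- assert (Hc : filterlim (fun x => exp (- x) * exp (sqrt x) * (- a / (x - a)))
    (at_right 0) (locally 1)).
  { replace 1 with (exp (- 0) * exp (sqrt 0) * (- a / (0 - a))).
    - apply (continuous_filterlim_at_right
        (fun x => exp (- x) * exp (sqrt x) * (- a / (x - a)))).
      apply (continuous_mult (fun x => exp (- x) * exp (sqrt x))
        (fun x => - a / (x - a))).
      + apply (continuous_mult (fun x => exp (- x)) (fun x => exp (sqrt x))).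
        * apply (ex_derive_continuous (fun x => exp (- x))).
          auto_derive. exact I.
        (* [sqrt] is continuous but not differentiable at 0. *)
        * apply (continuous_comp sqrt exp).
          -- apply continuous_sqrt.
          -- apply (ex_derive_continuous exp). auto_derive. exact I.
      + apply (ex_derive_continuous (fun x => - a / (x - a))).
        auto_derive. lra.
    - rewrite sqrt_0, Ropp_0, exp_0. field. lra. }
  (* Continuity at 0 fails here: [ln 0] is 0 by convention, so [Rpower 0 (- a / 2)] is 1. Hence the
     one-sided limit of the power. *)
  assert (Hr : filterlim (fun x => / (1 - Rpower x (- a / 2)))
    (at_right 0) (locally 1)).
  { apply (filterlim_comp _ _ _ (fun x => Rpower x (- a / 2))
      (fun u => / (1 - u)) _ (locally 0) _).
    - apply filterlim_Rpower_at_right_0. lra.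
    - replace (locally 1) with (locally (/ (1 - 0)))
        by (f_equal; field).
      apply (ex_derive_continuous (fun u => / (1 - u)) 0).
      auto_derive. lra. }
  change (Rbar_locally 1) with (locally 1).
  replace (locally 1) with (locally (1 * 1)) by (f_equal; ring).
  eapply filterlim_comp_2; [exact Hc | exact Hr |].
  apply (filterlim_mult (K := R_AbsRing) 1 1).
Qed.

(** * Exactness of the lower bound, and the theorem *)

Lemma exact_at_infty_g_lo (a : R) : a < -1 -> exact_at_infty a (g_lo a).
Proof.
intros Ha.
apply (is_lim_ext_loc (fun x => bounds_ratio a x * (g_up a x / Gamma a x))).
- exists 0. intros x Hx.
  rewrite (g_lo_ratio a x) by (try apply g_lo_denom_pos; lra).
  unfold Rdiv. ring.
- replace (Finite 1) with (Rbar_mult 1 1) by (simpl; f_equal; ring).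
  apply is_lim_mult.
  + apply bounds_ratio_lim_infty. lra.
  + apply exact_at_infty_g_up. lra.
  + exact I.
Qed.

(** At 0 the denominator in [bounds_ratio] is [a * (a + 1)], nonzero for [a < -1], so the ratio is
    continuous there with value 1. *)
Lemma exact_at_zero_g_lo (a : R) : a < -1 -> exact_at_zero a (g_lo a).
Proof.
intros Ha.
apply (filterlim_ext_loc
  (fun x => bounds_ratio a x * (g_up a x / Gamma a x))).
- exists (mkposreal 1 Rlt_0_1). intros x _ Hx.
  rewrite (g_lo_ratio a x) by (try apply g_lo_denom_pos; lra).
  unfold Rdiv. ring.
- assert (Hr : filterlim (bounds_ratio a) (at_right 0) (locally 1)).
  { replace 1 with (bounds_ratio a 0).
    - apply (continuous_filterlim_at_right (bounds_ratio a)).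
      apply (ex_derive_continuous (bounds_ratio a)).
      unfold bounds_ratio. auto_derive. nra.
    - unfold bounds_ratio. field. nra. }
  replace (locally 1) with (locally (1 * 1)) by (f_equal; ring).
  eapply filterlim_comp_2;
    [exact Hr | exact (exact_at_zero_g_up a ltac:(lra)) |].
  apply (filterlim_mult (K := R_AbsRing) 1 1).
Qed.

Theorem theorem1p2 :
  (forall a : R, a < -1 ->
     (forall x : R, 0 < x -> g_lo a x < Gamma a x < g_up a x) /\
     (exact_at_zero a (g_lo a) /\ exact_at_infty a (g_lo a)) /\
     (exact_at_zero a (g_up a) /\ exact_at_infty a (g_up a))) /\
  (forall a : R, a < 0 ->
     (forall x : R, 0 < x -> Gamma a x < g_up a x) /\
     exact_at_zero a (g_up a) /\ exact_at_infty a (g_up a)).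
Proof.
assert (Hup : forall a : R, a < 0 ->
     (forall x : R, 0 < x -> Gamma a x < g_up a x) /\
     exact_at_zero a (g_up a) /\ exact_at_infty a (g_up a)).
{ intros a Ha. repeat split.
  - intros x Hx. now apply Gamma_lt_g_up.
  - now apply exact_at_zero_g_up.
  - now apply exact_at_infty_g_up. }
split; [| exact Hup].
intros a Ha. destruct (Hup a ltac:(lra)) as [Hlt Hexact].
repeat split; try apply Hexact.
- apply g_lo_lt_Gamma; [lra | assumption |].
  intros t Ht. apply g_lo_denom_pos; lra.
- now apply Hlt.
- now apply exact_at_zero_g_lo.
- now apply exact_at_infty_g_lo.
Qed.
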